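(* Let $G$ be a cubic graph that has a $2$-factor $F$ (a spanning subgraph in which every vertex has degree $2$, i.e., a spanning collection of vertex-disjoint cycles) such that no cycle of $F$ has length $3$ or $5$. Then the circular chromatic index of $G$ is at most $7/2$; equivalently, $G$ admits a $(7,2)$-edge-coloring.
   Context: For integers $p\ge 2q\ge 2$, a $(p,q)$-coloring of a graph is an assignment of colors from $\{1,\ldots,p\}$ to its vertices such that any two adjacent vertices receive colors $a,b$ with $q\le |a-b|\le p-q$. The circular chromatic number of a graph is the infimum of $p/q$ over all $(p,q)$ such that the graph has a $(p,q)$-coloring. The circular chromatic index of a graph is the circular chromatic number of its line graph; a $(p,q)$-edge-coloring is a $(p,q)$-coloring of the line graph (adjacent edges receive colors $a,b$ with $q\le|a-b|\le p-q$). *)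

(* Defs.v *)
From HB Require Import structures.
From mathcomp Require Import all_boot all_order all_algebra.
From mathcomp Require Import classical_sets reals.

Set Implicit Arguments.
Unset Strict Implicit.
Unset Printing Implicit Defensive.

Import Order.TTheory GRing.Theory Num.Theory.

Local Open Scope ring_scope.

Record sgraph := SGraph {
  vertex :> finType;
  adj : rel vertex;
  adj_sym : symmetric adj;
  adj_irrefl : irreflexive adj }.

Definition regular (V : finType) (f : rel V) (d : nat) : Prop :=
  forall x : V, #|[set y | f x y]| = d.

Definition cubic (G : sgraph) : Prop := regular (@adj G) 3.

(* A spanning subgraph of G is given by its adjacency relation F on the
   vertices of G. *)
Definition two_factor (G : sgraph) (F : rel G) : Prop :=
  [/\ symmetric F, subrel F (@adj G) & regular F 2].

(* A cycle is given by its cyclic sequence of distinct vertices, so its length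
   is the size of c; the size bound excludes the degenerate cases admitted by
   ucycle (the empty sequence, and an edge traversed back and forth). *)
Definition graph_cycle (V : finType) (f : rel V) (c : seq V) : Prop :=
  (2 < size c)%N /\ ucycle f c.

Section LineGraph.
Variable G : sgraph.

Definition edge_set : {set {set G}} :=
  [set [set xy.1; xy.2] | xy : G * G & adj xy.1 xy.2].

Definition edge : finType := {a : {set G} | a \in edge_set}.

Definition line_adj : rel edge :=
  fun a b => (a != b) && ~~ [disjoint val a & val b].

Lemma line_adj_sym : symmetric line_adj.
Proof. by move=> a b; rewrite /line_adj eq_sym disjoint_sym. Qed.

Lemma line_adj_irrefl : irreflexive line_adj.
Proof. by move=> a; rewrite /line_adj eqxx. Qed.

Definition line_graph : sgraph := SGraph line_adj_sym line_adj_irrefl.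
End LineGraph.

(* `|m - n|%N is the (non-truncated) distance between m and n, whereas
   p - q is truncated, which is harmless since p >= 2q wherever it is used. *)
Definition circ_coloring (G : sgraph) (p q : nat) (col : G -> nat) : Prop :=
  (forall x, (1 <= col x <= p)%N) /\
  (forall x y, adj x y -> (q <= `|col x - col y| <= p - q)%N).

Definition circ_colorable (G : sgraph) (p q : nat) : Prop :=
  exists col : G -> nat, circ_coloring p q col.

Definition circ_edge_colorable (G : sgraph) (p q : nat) : Prop :=
  circ_colorable (line_graph G) p q.

(* The set is bounded below by 2, and nonempty since G is finite, so inf is a
   genuine infimum. *)
Definition circ_chromatic_number (R : realType) (G : sgraph) : R :=
  inf [set r : R | exists p q : nat,
    [/\ (2 <= 2 * q <= p)%N, circ_colorable G p q & r = p%:R / q%:R]]%classic.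

Definition circ_chromatic_index (R : realType) (G : sgraph) : R :=
  circ_chromatic_number R (line_graph G).

(* Main.v *)
Require Import Defs.
From HB Require Import structures.
From mathcomp Require Import all_boot all_order all_algebra.
From mathcomp Require Import reals.

(* Give every edge outside F the colour 1 or 2. The edges of an even cycle of F
   can then alternate between 4 and 6. An odd cycle can be coloured as soon as
   the non-F edges at four consecutive vertices of it are coloured a, a, b, b
   with a <> b: the three F-edges joining these vertices are coloured 3, 5, 7 in
   the order determined by a, and the others alternate between 4 and 6. Six
   consecutive vertices v0, ..., v5 contain such a pattern whenever the colours
   differ at v0 and v5, at v1 and v3, and at v2 and v4; these three requirements
   are disjoint "links". The odd cycles are treated one at a time: the links
   chosen so far, together with the edges outside F, amount to a matching on the
   remaining vertices whose edges are signed "equal" or "unequal". As its length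
   is odd, the next cycle has a vertex u that this matching does not join to
   another vertex of the cycle; as its length is at least 7, one of the six
   windows through u has links consistent with the matching. *)

Set Implicit Arguments.
Unset Strict Implicit.
Unset Printing Implicit Defensive.

(** * Orienting the cycles of a 2-regular graph *)

Section Orientation.
Variables (V : finType) (F : rel V).
Hypotheses (F_sym : symmetric F) (F_irr : irreflexive F) (F_reg : regular F 2).

Definition other (x y : V) : V := odflt y [pick z | F y z & z != x].

Lemma others1 (x y : V) : F x y -> [set z | F y z] :\ x = [set other x y].
Proof.
move=> Fxy; have := F_reg y; rewrite (cardsD1 x) inE F_sym Fxy => -[] /eqP/cards1P[z ez].
rewrite ez; congr [set _]; rewrite /other; case: pickP => [t|/(_ z)] /=.
  by move: ez => /setP/(_ t); rewrite !inE andbC => -> /eqP.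
by move: ez => /setP/(_ z); rewrite !inE andbC eqxx => ->.
Qed.

Lemma otherP (x y : V) : F x y -> F y (other x y) /\ other x y != x.
Proof.
by move=> /others1/setP/(_ (other x y)); rewrite !inE eqxx => /andP[].
Qed.

Lemma other_uniq (x y z : V) : F x y -> F y z -> z != x -> z = other x y.
Proof.
by move=> /others1/setP/(_ z) + Fyz zx; rewrite !inE Fyz zx => /esym/eqP.
Qed.

(** Being the identity off the darts of F, [turn] permutes all pairs, so [fconnect turn] is
    symmetric. *)
Definition turn (d : V * V) : V * V :=
  if F d.1 d.2 then (d.2, other d.1 d.2) else d.

Definition rev_dart (d : V * V) : V * V := (d.2, d.1).

Lemma turn_dart (d : V * V) : F d.1 d.2 -> F (turn d).1 (turn d).2.
Proof. by move=> Fd; rewrite /turn Fd /=; case: (otherP Fd). Qed.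

Lemma turn_rev (d : V * V) : F d.1 d.2 -> turn (rev_dart (turn d)) = rev_dart d.
Proof.
case: d => x y /= Fxy; have [Fyo ox] := otherP Fxy.
rewrite {2}/turn /= Fxy /rev_dart /turn /= F_sym Fyo; congr pair.
by symmetry; apply: other_uniq; rewrite 1?F_sym // eq_sym.
Qed.

Lemma turn_inj : injective turn.
Proof.
move=> [x y] [x' y'] e.
have Fe : F x y = F x' y'.
  have stuck d : ~~ F d.1 d.2 -> turn d = d by rewrite /turn => /negbTE->.
  have Ft d : F (turn d).1 (turn d).2 = F d.1 d.2.
    have [/[dup] Fd /turn_dart->//|/[dup] nFd /stuck->] := boolP (F d.1 d.2).
    by rewrite (negbTE nFd).
  by rewrite -(Ft (x, y)) -(Ft (x', y')) e.
have [Fxy|nF] := boolP (F x y); last by move: e; rewrite /turn /= -Fe (negbTE nF).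
have := turn_rev (d := (x, y)) Fxy; rewrite e turn_rev /= -?Fe //.
by rewrite /rev_dart /= => -[-> ->].
Qed.

(* If k turns lead from a dart to its reverse then, [turn] being conjugated to
   its inverse by reversal, the middle of this walk is a dart that equals its own
   reverse (k even) or is turned into it (k odd). *)
Lemma fconnect_rev (d : V * V) : F d.1 d.2 -> ~~ fconnect turn d (rev_dart d).
Proof.
move=> Fd; apply/negP => /iter_findex; set k := findex _ _ _ => ek.
have Fi i : F (iter i turn d).1 (iter i turn d).2 by elim: i => //= i; apply: turn_dart.
have step i : i <= k -> iter (k - i) turn d = rev_dart (iter i turn d).
  elim: i => [|i IH] lik; first by rewrite subn0 ek.
  apply: turn_inj; rewrite -iterS subnSK // IH 1?ltnW //.
  by rewrite iterS (turn_rev (Fi i)).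
have := odd_double_half k; rewrite -addnn; move: k./2 => j; case: (odd k) => /= hk.
  have := step j; rewrite -{1 2}hk add1n -addSn leq_addl addnK => /(_ isT).
  have := Fi j; rewrite iterS; case: (iter _ _ _) => [x y] /= Fxy.
  have [_] := otherP Fxy; rewrite /turn /= Fxy => + -[].
  by move=> + exy; rewrite exy eqxx.
have := step j; rewrite -{1 2}hk add0n leq_addl addnK => /(_ isT).
by have := Fi j; case: (iter _ _ _) => [x y] /= Fxy [exy _]; rewrite exy F_irr in Fxy.
Qed.

(* The two traversals of an F-cycle are different orbits of [turn]; comparing
   their roots selects one of them. *)
Definition forward (d : V * V) : bool :=
  enum_rank (froot turn d) < enum_rank (froot turn (rev_dart d)).

Lemma froot_rev_turn (d : V * V) : F d.1 d.2 ->
  froot turn (rev_dart (turn d)) = froot turn (rev_dart d).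
Proof.
move=> Fd; apply/eqP; rewrite (root_connect (fconnect_sym turn_inj)).
by rewrite -(turn_rev Fd) fconnect1.
Qed.

Lemma forward_turn (d : V * V) : F d.1 d.2 -> forward (turn d) = forward d.
Proof.
move=> Fd; rewrite /forward froot_rev_turn //; congr (enum_rank _ < _).
by apply/eqP; rewrite (root_connect (fconnect_sym turn_inj)) (fconnect_sym turn_inj) fconnect1.
Qed.

(** The two ranks cannot tie: by [fconnect_rev] the orbits have different roots. *)
Lemma forward_rev (d : V * V) : F d.1 d.2 -> forward (rev_dart d) = ~~ forward d.
Proof.
move=> Fd; rewrite /forward -leqNgt [RHS]leq_eqVlt /rev_dart -surjective_pairing.
case: eqP => [/ord_inj e|//]; have /eqP := enum_rank_inj e.
rewrite (root_connect (fconnect_sym turn_inj)) -[(d.2, d.1)]/(rev_dart d).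
by rewrite (fconnect_sym turn_inj) (negbTE (fconnect_rev Fd)).
Qed.

Lemma forward_other (x y : V) : F x y -> forward (y, other x y) = forward (x, y).
Proof. by move=> Fxy; rewrite -(forward_turn (d := (x, y))) // /turn /= Fxy. Qed.

Lemma two_regular_orientation : exists s : V -> V,
  [/\ injective s, forall x, F x (s x), forall x, s (s x) != x &
      forall x y, F x y -> y = s x \/ x = s y].
Proof.
have ex x : exists y, F x y && forward (x, y).
  have /card_gt0P[y] : 0 < #|[set y | F x y]| by rewrite F_reg.
  rewrite inE => Fxy; have [fxy|bxy] := boolP (forward (x, y)).
    by exists y; rewrite Fxy fxy.
  have Fyx : F y x by rewrite F_sym.
  (* The dart from y to x is forward, hence so is its turn, which leaves x. *)
  exists (other y x); have [-> _] := otherP Fyx.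
  by rewrite forward_other // -[(y, x)]/(rev_dart (x, y)) forward_rev.
pose s x := xchoose (ex x).
have sP x : F x (s x) by have /andP[] := xchooseP (ex x).
have sf x : forward (x, s x) by have /andP[] := xchooseP (ex x).
(* Otherwise the turn of (x, y) is the reverse of (x', y), both forward and backward. *)
have uniq_in x x' y : F x y -> F x' y -> forward (x, y) -> forward (x', y) -> x = x'.
  move=> Fxy Fx'y fxy fx'y; apply/eqP; apply: contraT => xx'.
  have Fyx' : F y x' by rewrite F_sym.
  have := forward_other Fxy; rewrite -(other_uniq Fxy Fyx') 1?eq_sym // fxy.
  by rewrite -[(y, x')]/(rev_dart (x', y)) forward_rev ?fx'y.
have uniq_out x y y' : F x y -> F x y' -> forward (x, y) -> forward (x, y') -> y = y'.
  move=> Fxy Fxy' fxy fxy'; apply/eqP; apply: contraT => yy'.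
  have Fyx : F y x by rewrite F_sym.
  have := forward_other Fyx; rewrite -(other_uniq Fyx Fxy') 1?eq_sym // fxy'.
  by rewrite -[(y, x)]/(rev_dart (x, y)) forward_rev ?fxy.
exists s; split=> // [x y e|x|x y Fxy].
- by apply: (uniq_in _ _ (s x)); rewrite // e.
- have Fxs := sP x; have [Fso ox] := otherP Fxs.
  suff -> : s (s x) = other x (s x) by [].
  by apply: (uniq_out (s x)); rewrite ?forward_other.
- have [fxy|bxy] := boolP (forward (x, y)).
    by left; apply: (uniq_out x).
  right; apply: (uniq_out y); rewrite // 1?F_sym //.
  by rewrite -[(y, x)]/(rev_dart (x, y)) forward_rev.
Qed.

End Orientation.

(* Nested tests are decided innermost first. *)
Ltac case_eqs := repeat (match goal with
  | |- context [?x == ?y] =>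
    lazymatch x with context [if _ then _ else _] => fail | _ => idtac end;
    case: (x =P y) => ? //=
  end; try congruence).

(** * Signed matchings and the suppression of links *)

Section SignedMatchings.
Variable V : finType.
Implicit Types (N : V -> V) (s c : V -> bool).

(* A fixed point of N is an unmatched vertex. *)
Definition signed_matching N s :=
  [/\ involutive N, forall v, s (N v) = s v & forall v, N v = v -> s v = false].

Definition respects N s c := forall v, c v (+) c (N v) = s v.

(* The signed matching induced off {a, b} by N and the requirement c a != c b:
   the path N a - a - b - N b is replaced with a single edge. *)
Definition suppress N (a b v : V) : V :=
  if (v == a) || (v == b) then v
  else if N v == a then if N b == b then v else N b
  else if N v == b then if N a == a then v else N a
  else N v.

(** The new edge carries the sum of the signs along the path, the link itself counting as
    unequal. *)
Definition suppress_sign N s (a b v : V) : bool :=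
  if (v == a) || (v == b) then false
  else if N v == a then if N b == b then false else ~~ (s v (+) s b)
  else if N v == b then if N a == a then false else ~~ (s v (+) s a)
  else s v.

Lemma suppress_matching N s (a b : V) : signed_matching N s -> a <> b ->
  signed_matching (suppress N a b) (suppress_sign N s a b).
Proof.
move=> [NK sN s0] ab.
have Ka := NK a; have Kb := NK b.
split=> v; have Kv := NK v; have sv := sN v; have s0v := s0 v.
- by rewrite /suppress; case_eqs.
- have sa := sN a; have sb := sN b.
  rewrite /suppress /suppress_sign; case_eqs.
  all: rewrite ?Ka ?Kb; case_eqs; try (rewrite addbC; congr (~~ (_ (+) _)); congruence).
- rewrite /suppress /suppress_sign; case_eqs.
Qed.

Lemma suppress_extend N s (a b : V) (c' : V -> bool) :
  signed_matching N s -> a <> b -> (N a = b -> s a = true) ->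
  respects (suppress N a b) (suppress_sign N s a b) c' ->
  exists c, [/\ respects N s c, c a != c b & forall v, v != a -> v != b -> c v = c' v].
Proof.
move=> [NK sN s0] ab sab Hc'.
(* The value at a is forced by its partner if that is neither a nor b. If a is unmatched, it is
   chosen to suit b; if N a = b, either value will do. *)
pose ca := if N a == b then true else
           if N a == a then ~~ (c' (N b) (+) s b) else c' (N a) (+) s a.
pose c v := if v == a then ca else if v == b then ~~ ca else c' v.
have Ka := NK a; have Kb := NK b; have sa := sN a; have sb := sN b.
exists c; split=> [v||v /negbTE va /negbTE vb]; last by rewrite /c va vb.
- have Kv := NK v; have sv := sN v; have s0v := s0 v; have s0a := s0 a; have s0b := s0 b.
  have := Hc' v; have := Hc' (N a); have := Hc' (N b).
  rewrite /c /ca /suppress /suppress_sign.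
  case_eqs; repeat match goal with
    | |- context [c' ?x] => let E := fresh in case E: (c' x)
    | |- context [s ?x] => let E := fresh in case E: (s x)
    end; rewrite //=;
    try have ? := sab ltac:(assumption); try have ? := s0v ltac:(assumption);
    try have ? := s0a ltac:(assumption); try have ? := s0b ltac:(assumption); congruence.
- by rewrite /c eqxx; case: (b =P a) => [/esym//|_]; rewrite eqxx; case: (ca).
Qed.

(* The links a - b and a' - b' close no cycle of odd sign with N. *)
Definition linkable N s (a b a' b' : V) : bool :=
  [&& (N a == b) ==> s a, (N a' == b') ==> s a' &
      (N a' == a) && (N b' == b) || (N a' == b) && (N b' == a) ==> (s a' == s b')].

(** The links are suppressed in turn and the colouring is extended back in reverse order. An edge a'
    - b' met by the second suppression either belongs to N or replaces a path through a and b, and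
    is then unequal exactly when s a' = s b'. The partner of u survives both suppressions, so the
    third link closes no cycle. *)
Lemma three_links N s (a b a' b' u w : V) :
  signed_matching N s -> uniq [:: a; b; a'; b'; u; w] ->
  N u \notin [:: a; b; a'; b'; w] -> linkable N s a b a' b' ->
  exists N' s', signed_matching N' s' /\
    forall c', respects N' s' c' ->
    exists c, [/\ respects N s c, [/\ c a != c b, c a' != c b' & c u != c w] &
      forall v, v \notin [:: a; b; a'; b'; u; w] -> c v = c' v].
Proof.
move=> mN; have [NK sN s0] := mN.
rewrite /= !inE !negb_or -!andbA.
do ![case/andP => /eqP ?] => _ /and5P[/eqP ? /eqP ? /eqP ? /eqP ? /eqP ?].
case/and3P => /implyP ok1 /implyP ok2 /implyP ok3.
have sa : N a = b -> s a = true by move/eqP/ok1.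
have mN1 := suppress_matching mN (a := a) (b := b) ltac:(assumption).
set N1 := suppress N a b in mN1; set s1 := suppress_sign N s a b in mN1.
have sa1 : N1 a' = b' -> s1 a' = true.
  have sb := sN b; have Kb := NK b; have Kb' := NK b'; have sb' := sN b'.
  have Ka := NK a; have sb0 := sN a.
  have ok2' : N a' = b' -> s a' = true by move/eqP/ok2.
  have ok3' : N a' = a -> N b' = b -> s a' = s b'.
    by move=> e1 e2; apply/eqP/ok3; rewrite e1 e2 !eqxx.
  have ok3'' : N a' = b -> N b' = a -> s a' = s b'.
    by move=> e1 e2; apply/eqP/ok3; rewrite e1 e2 !eqxx orbT.
  rewrite /N1 /s1 /suppress /suppress_sign; case_eqs.
  - move=> e; have e' : N b' = b by congruence.
    have -> : s b = s b' by congruence.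
    by rewrite ok3' // addbb.
  - move=> e; have e' : N b' = a by congruence.
    have -> : s a = s b' by congruence.
    by rewrite ok3'' // addbb.
have mN2 := suppress_matching mN1 (a := a') (b := b') ltac:(assumption).
set N2 := suppress N1 a' b' in mN2; set s2 := suppress_sign N1 s1 a' b' in mN2.
have N1u : N1 u = N u by rewrite /N1 /suppress; case_eqs.
have N2u : N2 u = N u by rewrite /N2 /suppress N1u; case_eqs.
have mN3 := suppress_matching mN2 (a := u) (b := w) ltac:(assumption).
exists (suppress N2 u w), (suppress_sign N2 s2 u w); split=> // c'.
case/(suppress_extend mN2) => // [|c2 [rc2 c2u off2]]; first by rewrite N2u.
have [//|c1 [rc1 c1a off1]] := suppress_extend mN1 _ sa1 rc2.
have [//|c [rc ca off]] := suppress_extend mN _ sa rc1.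
exists c; split=> // [|v].
  by split; rewrite // ?(off u) ?(off w) ?off1 ?(off a') ?(off b') //;
    apply/eqP; auto using not_eq_sym.
rewrite !inE !negb_or => /and5P[va vb va' vb' /andP[vu vw]].
by rewrite off // off1 // off2.
Qed.

End SignedMatchings.

(** * Some window through u has consistent links *)

Section FiniteCheck.
Variables (V : finType) (N : V -> V) (s : V -> bool).
Hypothesis mN : signed_matching N s.

Lemma not_linkable (a b a' b' : V) : ~~ linkable N s a b a' b' ->
  [\/ N a = b /\ s a = false, N a' = b' /\ s a' = false,
      [/\ N a' = a, N b' = b & s a' <> s b'] | [/\ N a' = b, N b' = a & s a' <> s b']].
Proof.
rewrite /linkable !negb_and !negb_imply.
case/or3P => [/andP[/eqP ? /negbTE ?]|/andP[/eqP ? /negbTE ?]|/andP[]].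
- by constructor 1.
- by constructor 2.
- by case/orP => /andP[/eqP ? /eqP ?] /eqP; [constructor 3|constructor 4].
Qed.

(* v 5 plays the role of u. The six windows through it start at v 5, v 0, v 4,
   v 1, v 3 and v 2; the two links listed for each are those that avoid v 5 (the
   link at v 5 closes no cycle), so that v 0 and v 10 do not occur. *)
Definition some_linkable (v : nat -> V) :=
  [|| linkable N s (v 1) (v 3) (v 2) (v 4), linkable N s (v 6) (v 8) (v 7) (v 9),
      linkable N s (v 4) (v 9) (v 6) (v 8), linkable N s (v 1) (v 6) (v 2) (v 4),
      linkable N s (v 3) (v 8) (v 4) (v 6) | linkable N s (v 2) (v 7) (v 4) (v 6)].

Variable v : nat -> V.

Definition same (i j : nat) := (N (v i) = v j /\ N (v j) = v i) /\ s (v i) = s (v j).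

Lemma sameP i j : N (v i) = v j -> same i j.
Proof.
have [NK sN _] := mN; move=> e; split; last by rewrite -e sN.
by rewrite -e NK.
Qed.

Lemma same_sym i j : same i j -> same j i.
Proof. by case=> -[? ?] ?; do !split. Qed.

Ltac clash := match goal with
  | H : same ?i ?j, H' : same ?i ?k |- _ => exfalso;
    lazymatch j with k => fail | _ => idtac end;
    have := H.1.1; rewrite H'.1.1;
    match goal with I : forall i j, _ -> _ -> v i = v j -> i = j |- _ =>
      by move/I => /(_ isT isT) end
  end.

Ltac signs := exfalso;
  repeat match goal with H : same _ _ |- _ => case: H => _ ? end;
  repeat match goal with H : s _ <> s _ |- _ => move: H end;
  repeat match goal with |- context [s ?x] => let E := fresh in case E: (s x) end;
  congruence.

Ltac branch H :=
  let E := fresh in let E' := fresh in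
  case: H => [[/sameP E ?]|[/sameP E ?]|[/sameP E /sameP E' ?]|[/sameP E /sameP E' ?]];
  move/same_sym: (E) => ?; try (move/same_sym: (E') => ?); try clash.

(** Each of the six failures prescribes edges of N among the v i in one of four ways. Every
    combination gives some vertex two partners or contradictory signs. *)
Lemma some_linkable_9 : {in [pred i | 0 < i < 10] &, injective v} -> some_linkable v.
Proof.
move=> vI.
have I i j : 0 < i < 10 -> 0 < j < 10 -> v i = v j -> i = j by move=> ? ?; apply: vI.
apply: contraT; rewrite /some_linkable !negb_or.
case/and5P=> /not_linkable H1 /not_linkable H2 /not_linkable H3 /not_linkable H4.
case/andP=> /not_linkable H5 /not_linkable H6.
branch H5; branch H6; branch H3; branch H4; branch H1; branch H2; signs.
Qed.

(** On a cycle of length 7 the positions 8 and 9 wrap around; every longer odd cycle has nine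
    distinct positions. *)
Lemma some_linkable_7 : {in [pred i | 0 < i < 8] &, injective v} ->
  v 8 = v 1 -> v 9 = v 2 -> some_linkable v.
Proof.
move=> vI v8 v9; rewrite /some_linkable v8 v9.
have I i j : 0 < i < 8 -> 0 < j < 8 -> v i = v j -> i = j by move=> ? ?; apply: vI.
apply: contraT; rewrite !negb_or.
case/and5P=> /not_linkable H1 /not_linkable H2 /not_linkable H3 /not_linkable H4.
case/andP=> /not_linkable H5 /not_linkable H6.
branch H5; branch H6; branch H3; branch H4; branch H1; branch H2; signs.
Qed.

End FiniteCheck.

Lemma fixfree_involution_even (V : finType) (N : V -> V) (A : {set V}) :
  involutive N -> (forall v, v \in A -> N v \in A /\ N v != v) -> ~~ odd #|A|.
Proof.
(* B takes the element of smaller rank from each pair, so A is the disjoint union of B and its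
   image. *)
move=> NK NA; pose B := [set v in A | enum_rank v < enum_rank (N v)].
have AB : A = B :|: N @: B.
  apply/setP => v; rewrite !inE; apply/idP/idP => [vA|/orP[/andP[]//|]].
    have [NvA Nv] := NA v vA; rewrite vA /=; case: ltngtP => //= [lt|/ord_inj/enum_rank_inj e].
      by apply/imsetP; exists (N v); rewrite ?inE ?NK ?NvA.
    by rewrite -e eqxx in Nv.
  by case/imsetP => w; rewrite inE => /andP[/NA[? _] _] ->.
have dB : B :&: N @: B = set0.
  apply/setP => v; rewrite !inE; apply/negP => /andP[/andP[_ lt]] /imsetP[w].
  by rewrite inE => /andP[_ lt'] e; move: lt; rewrite e NK ltnNge (ltnW lt').
by rewrite AB cardsU dB cards0 subn0 card_imset ?addnn ?odd_double //; apply: can_inj NK.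
Qed.

(** * Settling the odd cycles one at a time *)

Section OddCycle.
Variables (V : finType) (nx : V -> V).
Hypothesis nx_inj : injective nx.
Implicit Types (N : V -> V) (s c : V -> bool).

Definition split_pairs c (y : V) : bool :=
  [&& c y == c (nx y), c (nx y) != c (nx (nx y)) & c (nx (nx y)) == c (nx (nx (nx y)))].

Lemma iter_nx_inj (x : V) (i j : nat) : i < order nx x -> j < order nx x ->
  iter i nx x = iter j nx x -> i = j.
Proof. by move=> li lj e; rewrite -(findex_iter li) e findex_iter. Qed.

Lemma order_connect (x y : V) : fconnect nx x y -> order nx y = order nx x.
Proof.
by move=> xy; apply: eq_card => z; rewrite !inE (same_connect (fconnect_sym nx_inj) xy).
Qed.

(** If c agrees at v 1 and v 2, the pattern starts at v 1. Otherwise v 1, ..., v 4 are coloured a,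
    b, b, a; since v 0 and v 5 differ, one of them has colour a, and the pattern starts at v 0 or v
    2. *)
Lemma window_split_pairs c (y : V) (v := fun i => iter i nx y) :
  c (v 0) != c (v 5) -> c (v 1) != c (v 3) -> c (v 2) != c (v 4) ->
  exists2 z, fconnect nx y z & split_pairs c z.
Proof.
move=> h05 h13 h24.
have : [|| split_pairs c (v 0), split_pairs c (v 1) | split_pairs c (v 2)].
  move: h05 h13 h24; rewrite /split_pairs /=.
  by do 6 case: (c _).
by case/or3P => h; [exists (v 0)|exists (v 1)|exists (v 2)]; rewrite // fconnect_iter.
Qed.

(* The cycle through x can be settled at the price of replacing N by a signed
   matching N', after which it is insensitive to recolouring other cycles. *)
Definition solves_cycle N s (x : V) :=
  exists N' s', signed_matching N' s' /\
    forall c', respects N' s' c' ->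
    exists c, [/\ respects N s c, exists2 y, fconnect nx x y & split_pairs c y &
      forall v, ~~ fconnect nx x v -> c v = c' v].

(** The indices arrange the window into three links, of which k - l is the one at u; [win] matches
    them with the three requirements. *)
Lemma window_solves_cycle N s (y : V) (i j i' j' k l : nat) (v := fun i => iter i nx y) :
  signed_matching N s -> 6 < order nx y ->
  perm_eq [:: i; j; i'; j'; k; l] (iota 0 6) ->
  (fconnect nx y (N (v k)) -> N (v k) = v k) ->
  linkable N s (v i) (v j) (v i') (v j') ->
  (forall c, c (v i) != c (v j) -> c (v i') != c (v j') -> c (v k) != c (v l) ->
    [/\ c (v 0) != c (v 5), c (v 1) != c (v 3) & c (v 2) != c (v 4)]) ->
  solves_cycle N s y.
Proof.
move=> mN oy P Nk lk win.
have U : uniq [seq v i | i <- [:: i; j; i'; j'; k; l]].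
  rewrite map_inj_in_uniq ?(perm_uniq P) // => a b.
  rewrite !(perm_mem P) !mem_iota !add0n /= => la lb.
  by apply: iter_nx_inj; apply: leq_trans oy; apply: ltnW.
have vy m : fconnect nx y (v m) by apply: fconnect_iter.
have Nout : N (v k) \notin [:: v i; v j; v i'; v j'; v l].
  apply/negP => Nin.
  have /Nk e : fconnect nx y (N (v k)).
    by move: Nin; rewrite !inE => /or4P[/eqP->|/eqP->|/eqP->|/orP[]/eqP->].
  move: Nin U; rewrite e /= !inE !negb_or.
  move=> + /and5P[/and5P[_ _ _ n1 _] /and4P[_ _ n2 _] /and3P[_ n3 _] /andP[n4 _] /andP[n5 _]].
  by rewrite !(eq_sym (v k)) (negbTE n1) (negbTE n2) (negbTE n3) (negbTE n4) eq_sym (negbTE n5).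
have [N' [s' [mN' ext]]] := three_links mN U Nout lk.
exists N', s'; split=> // c' /ext [c [rc [n1 n2 n3] off]]; exists c; split=> //.
  by have [] := win c n1 n2 n3; apply: window_split_pairs.
move=> z zy; apply: off; apply/negP; rewrite !inE.
by move=> H; move/negP: zy; apply; move: H; do ![case/orP => [/eqP->//|]]; move/eqP->.
Qed.

Lemma odd_solves_cycle N s (x : V) : signed_matching N s ->
  odd (order nx x) -> 6 < order nx x -> solves_cycle N s x.
Proof.
move=> mN ox x6; have [NK _ _] := mN.
(* If N matched every vertex of the cycle to another one of it, the length would be even. *)
have [u xu Nu] : exists2 u, fconnect nx x u & fconnect nx x (N u) -> N u = u.
  have : [exists u, fconnect nx x u && (fconnect nx x (N u) ==> (N u == u))].
    apply: contraTT ox => /existsPn H.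
    rewrite /order -[#|_|]/(#|fconnect nx x|) -cardsE.
    apply: (fixfree_involution_even NK) => v; rewrite !inE => xv.
    by have := H v; rewrite xv /= negb_imply => /andP[].
  by case/existsP => u /andP[xu /implyP H]; exists u => // /H/eqP.
(* Starting five steps before u puts u at v 5, so the window from v i has u at position 5 - i. *)
have [p xp up] : exists2 p, fconnect nx x p & u = iter 5 nx p.
  exists (iter (order nx u - 5) nx u); first by apply: connect_trans xu (fconnect_iter _ _ _).
  by rewrite -iterD subnKC ?iter_order // (order_connect xu) ltnW // ltnW.
pose v i := iter i nx p.
have ov i : order nx (v i) = order nx x.
  by apply: order_connect; apply: connect_trans xp (fconnect_iter _ _ _).
have cv i : fconnect nx (v i) =1 fconnect nx x.
  move=> z; apply/esym/(same_connect (fconnect_sym nx_inj)).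
  exact: connect_trans xp (fconnect_iter _ _ _).
have solve i : solves_cycle N s (v i) -> solves_cycle N s x.
  case=> N' [s' [mN' ext]]; exists N', s'; split=> // c' /ext [c [rc [y vy h] off]].
  by exists c; split=> // [|z xz]; [exists y; rewrite // -(cv i)|apply: off; rewrite cv].
have : some_linkable N s v.
  have v1 i j : i <= order nx x -> j <= order nx x -> 0 < i -> 0 < j -> v i = v j -> i = j.
    case: i j => [//|i] [//|j] li lj _ _ e; congr _.+1.
    by apply: (@iter_nx_inj (v 1)); rewrite ?ov // /v -!iterD !addn1.
  have [x8|x7] := leqP (order nx x) 8.
    have o7 : order nx x = 7.
      by case: (order nx x) x6 x8 ox => // -[|[|[|[|[|[|[|[|[|]]]]]]]]].
    have v7 i : v (i + 7) = v i by rewrite /v iterD -o7 -(ov 0) /= iter_order.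
    apply: (some_linkable_7 mN) => // [i j /andP[i0 i7] /andP[j0 j7]||].
    - by apply: v1; rewrite ?o7.
    - exact: (v7 1).
    - exact: (v7 2).
  apply: (some_linkable_9 mN) => // i j /andP[i0 i7] /andP[j0 j7].
  by apply: v1; rewrite ?(leq_trans _ x7).
have Nu' i k : i + k = 5 -> fconnect nx (v i) (N (iter k nx (v i))) ->
    N (iter k nx (v i)) = iter k nx (v i).
  by rewrite cv /v -iterD addnC => ->; rewrite -up.
have x6' i : 6 < order nx (v i) by rewrite ov.
rewrite /some_linkable.
case/or4P=> [lk|lk|lk|/or3P[]lk].
- apply: (solve 0); apply: (@window_solves_cycle _ _ _ 1 3 2 4 5 0) => //; first exact: Nu'.
  by move=> c; split; rewrite // eq_sym.
- apply: (solve 5); apply: (@window_solves_cycle _ _ _ 1 3 2 4 0 5) => //; first exact: Nu'.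
- apply: (solve 4); apply: (@window_solves_cycle _ _ _ 0 5 2 4 1 3) => //; first exact: Nu'.
- apply: (solve 1); apply: (@window_solves_cycle _ _ _ 0 5 1 3 4 2) => //; first exact: Nu'.
  by move=> c; split; rewrite // eq_sym.
- apply: (solve 3); apply: (@window_solves_cycle _ _ _ 0 5 1 3 2 4) => //; first exact: Nu'.
- apply: (solve 2); apply: (@window_solves_cycle _ _ _ 0 5 2 4 3 1) => //; first exact: Nu'.
  by move=> c; split; rewrite // eq_sym.
Qed.

Lemma split_pairs_coloring N s (r : seq V) : signed_matching N s ->
  (forall x, x \in r -> odd (order nx x) /\ 6 < order nx x) ->
  pairwise (fun x y => ~~ fconnect nx x y) r ->
  exists2 c, respects N s c &
    forall x, x \in r -> exists2 y, fconnect nx x y & split_pairs c y.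
Proof.
elim: r N s => [|x r IH] N s mN odd_r.
  move=> _; have [NK sN s0] := mN.
  (* Exactly one end of each unequal edge is coloured true. *)
  exists (fun v => s v && (enum_rank v < enum_rank (N v))) => // v.
  rewrite sN NK; case E: (s v) => //=.
  by case: ltngtP => // /ord_inj/enum_rank_inj/esym/s0; rewrite E.
rewrite /= => /andP[xr pr].
have [ox x6] := odd_r x (mem_head _ _).
have [N' [s' [mN' ext]]] := odd_solves_cycle mN ox x6.
(* The remaining cycles are coloured for N'; the extension to c changes colours on the cycle of x
   only, so their patterns survive. *)
have [|c' /ext [c [rc px off]] pc'] := IH N' s' mN' _ pr.
  by move=> z zr; apply: odd_r; rewrite inE zr orbT.
exists c => // z; rewrite inE => /orP[/eqP->//|zr].
have [y zy py] := pc' z zr; exists y => //.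
have off' i : c (iter i nx y) = c' (iter i nx y).
  apply: off; apply: contra (allP xr z zr) => xi.
  rewrite (connect_trans xi) // (fconnect_sym nx_inj).
  exact: connect_trans zy (fconnect_iter _ _ _).
by move: py; rewrite /split_pairs (off' 0) (off' 1) (off' 2) (off' 3).
Qed.

End OddCycle.

(* The colours of the two F-edges at a vertex, where its third edge is coloured
   1 if b is false and 2 if b is true. *)
Definition compatible (b : bool) (p q : nat) : bool :=
  (p, q) \in if b then [:: (4, 6); (6, 4); (4, 7); (7, 4); (5, 7); (7, 5)]
             else [:: (4, 6); (6, 4); (3, 5); (5, 3); (3, 6); (6, 3)].

Lemma compatible_sym b p q : compatible b p q -> compatible b q p.
Proof.
by case: b; rewrite /compatible !inE => /or4P[| | |/or3P[]] /eqP[-> ->].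
Qed.

(** * Colouring the edges of F *)

Section CycleColoring.
Variables (V : finType) (nx : V -> V) (c : V -> bool).
Hypothesis nx_inj : injective nx.
Hypothesis odd_split : forall x, odd (order nx x) ->
  6 < order nx x /\ exists2 y, fconnect nx x y & split_pairs nx c y.

(* The start of the pattern on the cycle of x, if this cycle is odd. *)
Definition base (x : V) : V :=
  if odd (order nx x) then
    odflt x [pick y | fconnect nx (froot nx x) y && split_pairs nx c y]
  else froot nx x.

Lemma froot_nx (x : V) : froot nx (nx x) = froot nx x.
Proof.
apply/eqP; rewrite (root_connect (fconnect_sym nx_inj)) (fconnect_sym nx_inj).
exact: fconnect1.
Qed.

Lemma base_odd (x : V) : odd (order nx x) -> split_pairs nx c (base x).
Proof.
move=> ox; rewrite /base ox; case: pickP => [y /andP[]//|no].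
have [_ [y xy py]] := odd_split ox; have := no y.
by rewrite py (connect_trans _ xy) // (fconnect_sym nx_inj) connect_root.
Qed.

Lemma base_connect (x : V) : fconnect nx (base x) x.
Proof.
rewrite (fconnect_sym nx_inj) /base; case: ifP => ox; last exact: connect_root.
case: pickP => [y /andP[ry _]|_] /=; last exact: connect0.
exact: connect_trans (connect_root _ _) ry.
Qed.

(** Only the default of [odflt] depends on the vertex rather than on its cycle, and [odd_split]
    rules it out. *)
Lemma base_nx (x : V) : base (nx x) = base x.
Proof.
rewrite /base froot_nx (order_connect nx_inj (fconnect1 nx x)).
case: ifP => // ox; case: pickP => // no; exfalso.
have [_ [y xy py]] := odd_split ox; have := no y.
by rewrite py (connect_trans _ xy) // (fconnect_sym nx_inj) connect_root.
Qed.

Definition pos (x : V) : nat := findex nx (base x) x.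

(** The default of [nth] produces the alternation: it starts with 4 after 7, or 6 after 3, and by
    oddness ends with 6 before the initial 3, or 4 before the initial 7. *)
Definition pos_color (o b : bool) (i : nat) : nat :=
  if o then nth (if odd i (+) b then 4 else 6) (if b then [:: 7; 5; 3] else [:: 3; 5; 7]) i
  else if odd i then 6 else 4.

Definition cycle_color (x : V) : nat :=
  pos_color (odd (order nx x)) (c (base x)) (pos x).

Lemma pos_nx (x : V) :
  pos (nx x) = if (pos x).+1 == order nx x then 0 else (pos x).+1.
Proof.
have bx := base_connect x; have ob := order_connect nx_inj bx.
have lt : (pos x).+1 <= order nx (base x) := findex_max bx.
have ex : nx x = iter (pos x).+1 nx (base x) by rewrite iterS iter_findex.
rewrite {1}/pos base_nx ob ex; case: eqP => [->|/eqP ne].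
  by rewrite iter_order // findex0.
by rewrite findex_iter // ltn_neqAle ne.
Qed.

Lemma cycle_color_compatible (x : V) :
  compatible (c (nx x)) (cycle_color x) (cycle_color (nx x)).
Proof.
have bx := base_connect x; have ob := order_connect nx_inj bx.
have ex : nx x = iter (pos x).+1 nx (base x) by rewrite iterS iter_findex.
rewrite /cycle_color (order_connect nx_inj (fconnect1 nx x)) base_nx pos_nx.
have [ox|ox] := boolP (odd (order nx x)); last first.
  rewrite /pos_color; case: eqP => [e|_] /=; last by case: odd; case: (c _).
  by rewrite -e /= negbK in ox; rewrite ox; case: (c _).
have [o2 _] := odd_split ox.
have /and3P[/eqP e1 /eqP n2 /eqP e2] := base_odd ox.
(* First the vertex where the cycle closes up, then the other pattern vertices and the alternating
   rest. *)
case: eqP => [e|ne].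
  have eb : nx x = base x by rewrite ex e ob iter_order.
  rewrite -e /= in ox; rewrite eb; move: ox o2; rewrite -e.
  case: (pos x) => [|[|[|i]]] //=; rewrite !negbK => oi _.
  by rewrite /pos_color; case: (c (base x)); rewrite /= !nth_nil /= ?negbK oi.
rewrite ex; case: (pos x) => [|[|[|i]]] /=; rewrite /pos_color /=.
- by rewrite -e1; case: (c (base x)).
- by move: n2; rewrite -e1; case: (c (base x)); case: (c _).
- by move: n2; rewrite -e2 -e1; case: (c (base x)); case: (c _).
- by case: (c (base x)); rewrite /= !nth_nil; case: (c _); case: (odd i).
Qed.

End CycleColoring.

Lemma cycle_decomposition_coloring (V : finType) (nx N : V -> V) :
  injective nx -> involutive N ->
  (forall x, odd (order nx x) -> 6 < order nx x) ->
  exists c : V -> bool, exists g : V -> nat,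
    (forall x, c (N x) = c x) /\ forall x, compatible (c (nx x)) (g x) (g (nx x)).
Proof.
move=> nx_inj NK big.
pose r := [seq x <- enum V | froots nx x && odd (order nx x)].
have r_odd x : x \in r -> odd (order nx x) /\ 6 < order nx x.
  by rewrite mem_filter => /andP[/andP[_ ox] _]; split=> //; apply: big.
(* An edge outside F has a single colour, so initially every sign is equal. *)
have mN : signed_matching N xpred0 by [].
have r_pw : pairwise (fun x y => ~~ fconnect nx x y) r.
  have : uniq r by rewrite filter_uniq // enum_uniq.
  rewrite uniq_pairwise; apply: (sub_in_pairwise (P := mem r)) (allss r) => x y.
  rewrite !mem_filter => /andP[/andP[/eqP rx _] _] /andP[/andP[/eqP ry _] _].
  apply: contra => xy; rewrite -rx -ry.
  by rewrite (root_connect (fconnect_sym nx_inj)).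
have [c cN hc] := split_pairs_coloring nx_inj mN r_odd r_pw.
exists c, (cycle_color nx c); split=> [x|].
  by have := cN x; case: (c x); case: (c (N x)).
apply: cycle_color_compatible => // x ox; split; first exact: big.
have xr : fconnect nx x (froot nx x) by apply: connect_root.
have [|y ry py] := hc (froot nx x).
  rewrite mem_filter mem_enum andbT (order_connect nx_inj xr) ox andbT.
  exact: (roots_root (fconnect_sym nx_inj)).
by exists y => //; apply: connect_trans ry.
Qed.

(** * From the cycles of F to an edge colouring of G *)

Section TwoFactor.
Variables (G : sgraph) (F : rel G).
Hypotheses (hG : cubic G) (hF : two_factor F).

Lemma complementary_matching : exists N : G -> G,
  [/\ involutive N, forall x, adj x (N x) /\ ~~ F x (N x) &
      forall x y, adj x y -> ~~ F x y -> y = N x].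
Proof.
have [F_sym F_adj F_reg] := hF.
have c1 x : exists y, [set y | adj x y] :\: [set y | F x y] = [set y].
  apply/cards1P; rewrite cardsD (setIidPr _) ?hG ?F_reg //.
  by apply/subsetP => y; rewrite !inE; apply: F_adj.
have c1P x : exists y, [set y | adj x y] :\: [set y | F x y] == [set y].
  by have [y /eqP] := c1 x; exists y.
pose N x := xchoose (c1P x).
have NP x y : (~~ F x y && adj x y) = (y == N x).
  by have /eqP/setP/(_ y) := xchooseP (c1P x); rewrite !inE.
have NF x : ~~ F x (N x) /\ adj x (N x) by apply/andP; rewrite NP.
exists N; split=> [x|x|x y xy nF].
- apply/esym/eqP; rewrite -NP F_sym adj_sym; exact/andP.
- by have [] := NF x.
- by apply/eqP; rewrite -NP xy nF.
Qed.

Lemma two_factor_edge_coloring :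
  (forall c : seq G, graph_cycle F c -> size c <> 3 /\ size c <> 5) ->
  circ_edge_colorable G 7 2.
Proof.
move=> hcyc; have [F_sym F_adj F_reg] := hF.
have F_irr : irreflexive F.
  by move=> x; apply/negP => /F_adj; rewrite adj_irrefl.
have [nx [nx_inj nxF nx2 nxP]] := two_regular_orientation F_sym F_irr F_reg.
have [N [NK N_adj N_uniq]] := complementary_matching.
have nx1 x : nx x != x by apply: contraTneq (nxF x) => ->; rewrite F_irr.
have order_big x : odd (order nx x) -> 6 < order nx x.
  move=> ox; have o2 : 2 < order nx x.
    have := iter_order nx_inj x; have := order_gt0 nx x.
    case: (order nx x) ox => [|[|[|]]] //= _ _ e.
    by have := nx1 x; rewrite e eqxx.
  have [] := hcyc (orbit nx x); rewrite ?size_orbit.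
    split; rewrite ?size_orbit //; apply/andP; split; last exact: orbit_uniq.
    apply: sub_cycle (cycle_orbit nx_inj x) => y z /eqP <-; exact: nxF.
  by case: (order nx x) ox o2 => [|[|[|[|[|[|[|]]]]]]].
have [c [g [cN gc]]] := cycle_decomposition_coloring nx_inj NK order_big.
(* Both picks are harmless: x is determined by an F-edge because nx (nx x) differs from x, and c
   agrees at the ends of any other edge. *)
pose col (E : {set G}) : nat :=
  if [pick x | E == [set x; nx x]] is Some x then g x
  else if [pick x in E] is Some x then (c x).+1 else 1.
have set2P (x y z t : G) : [set x; y] = [set z; t] -> x = z /\ y = t \/ x = t /\ y = z.
  move=> e; have : x \in [set z; t] by rewrite -e set21.
  have : y \in [set z; t] by rewrite -e set22.
  have : z \in [set x; y] by rewrite e set21.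
  have : t \in [set x; y] by rewrite e set22.
  rewrite !inE; do 4 case/orP => /eqP ?; subst; by [left|right].
have col_nx x : col [set x; nx x] = g x.
  rewrite /col; case: pickP => [y /eqP/set2P[[->]//|[e1 e2]]|/(_ x)].
    by have := nx2 y; rewrite -e1 e2 eqxx.
  by rewrite eqxx.
have col_N x : col [set x; N x] = (c x).+1.
  have [xN nF] := N_adj x.
  rewrite /col; case: pickP => [y /eqP/set2P[[e1 e2]|[e1 e2]]|_].
  - by have := nxF y; rewrite -e2 -e1 (negbTE nF).
  - by have := nxF y; rewrite -e1 -e2 F_sym (negbTE nF).
  case: pickP => [y|/(_ x)]; last by rewrite set21.
  by rewrite !inE => /orP[]/eqP->; rewrite ?cN.
have edge_ends (e : edge G) : exists a b, adj a b /\ val e = [set a; b].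
  by have /imsetP[[a b] /= + ee] := valP e; rewrite inE => ab; exists a, b.
have edgeP (e : edge G) x : x \in val e -> exists2 y, adj x y & val e = [set x; y].
  have [a [b [ab ->]]] := edge_ends e.
  rewrite !inE => /orP[]/eqP->; first by exists b.
  by exists a; rewrite 1?setUC // adj_sym.
have adj_cases x y : adj x y -> [\/ y = nx x, x = nx y | y = N x].
  move=> xy; have [/nxP[]|/N_uniq] := boolP (F x y).
  - by constructor 1.
  - by constructor 2.
  - by constructor 3; auto.
have g_range b p q : compatible b p q -> 1 <= p <= 7.
  by case: b; rewrite /compatible !inE => /or4P[| | |/or3P[]] /eqP[-> _].
have comp_dist b p q : compatible b p q ->
  [/\ 2 <= `|p - q| <= 7 - 2, 2 <= `|p - b.+1| <= 7 - 2 & 2 <= `|b.+1 - p| <= 7 - 2].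
  by case: b; rewrite /compatible !inE => /or4P[| | |/or3P[]] /eqP[-> ->].
have gc' x y : x = nx y -> compatible (c x) (g x) (g y).
  by move->; apply/compatible_sym/gc.
have gcr x : compatible (c x) (g x) (g (finv nx x)) by apply: gc'; rewrite f_finv.
exists (fun e => col (val e)); split=> [e|e e'].
  have [a [b [+ ->]]] := edge_ends e => /adj_cases[->|->|->].
  - by rewrite col_nx; apply: g_range (gcr a).
  - by rewrite setUC col_nx; apply: g_range (gcr b).
  - by rewrite col_N; case: (c a).
rewrite /adj /= => /andP[ee' /pred0Pn[x /= /andP[xe xe']]].
have [y xy ey] := edgeP e x xe; have [z xz ez] := edgeP e' x xe'.
have yz : y <> z by move=> yz; move: ee'; rewrite -val_eqE ey ez yz eqxx.
rewrite ey ez.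
have col_pre w : x = nx w -> col [set x; w] = g w by move->; rewrite setUC col_nx.
have pre w : x = nx w -> compatible (c x) (g w) (g x) by move=> e0; apply/compatible_sym/gc'.
(* Each edge at x leaves along nx, enters along nx or lies outside F; two of the same type would
   coincide. *)
case: (adj_cases x y xy) => ey'; case: (adj_cases x z xz) => ez'.
- by case: yz; rewrite ey' ez'.
- rewrite ey' col_nx (col_pre z) //; by case: (comp_dist _ _ _ (gc' _ _ ez')).
- by rewrite ey' ez' col_nx col_N; case: (comp_dist _ _ _ (gcr x)).
- rewrite ez' col_nx (col_pre y) //; by case: (comp_dist _ _ _ (pre _ ey')).
- by case: yz; apply: nx_inj; rewrite -ey'.
- by rewrite ez' (col_pre y) // col_N; case: (comp_dist _ _ _ (pre _ ey')).
- by rewrite ey' ez' col_nx col_N; case: (comp_dist _ _ _ (gcr x)).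
- by rewrite ey' (col_pre z) // col_N; case: (comp_dist _ _ _ (pre _ ez')).
- by case: yz; rewrite ey' ez'.
Qed.

End TwoFactor.

Import Order.TTheory GRing.Theory Num.Theory.

Local Open Scope ring_scope.

Theorem theorem5 (R : realType) (G : sgraph) (F : rel G)
  (hG : cubic G) (hF : two_factor F)
  (hcyc : forall c : seq G, graph_cycle F c -> size c <> 3%N /\ size c <> 5%N) :
  circ_chromatic_index R G <= 7 / 2 /\ circ_edge_colorable G 7 2.
Proof.
have col := two_factor_edge_coloring hG hF hcyc; split=> //.
apply: ge_inf; last by exists 7%N, 2%N; split.
by exists 0 => _ [p [q [_ _ ->]]]; rewrite divr_ge0.
Qed.
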